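(* Let $\zeta\in K$ be a (not necessarily primitive) fourth root of unity, let $B=B_\zeta$ with generators $u,v,r,s$, and let $B'=B_{-\zeta}$ with corresponding generators $u',v',r',s'$. There is a Hopf algebra isomorphism $f\colon B\to B'$ that takes the values $$f(u)=u'^3,\qquad f(v)=v',\qquad f(r)=r's',\qquad f(s)=s'$$ on the generators.
   Context: $K$ is an algebraically closed field of characteristic zero. For $\zeta\in K$ with $\zeta^4=1$, $B_\zeta$ denotes the following Hopf algebra (a Radford biproduct $A_\zeta\star K[\mathbb{Z}_2\times\mathbb{Z}_2]$). As an algebra it is generated by $u=u_\zeta$, $v=v_\zeta$, $r=r_\zeta$, $s=s_\zeta$ with defining relations $$u^4=1,\quad uv=vu,\quad v^2=\tfrac12(1+\zeta u+u^2-\zeta u^3),\quad r^2=1,\quad rs=sr,\quad s^2=1,$$ $$ru=u^3r,\quad rv=u^3vr,\quad su=us,\quad sv=u^2vs;$$ it has basis $u^iv^jr^ks^l$ ($0\le i\le3$, $0\le j,k,l\le1$). The elements $r$ and $s$ are group-like, the counit takes the value $1$ on $u,v,r,s$, and $$\Delta(u)=\tfrac12(u\otimes u+u\otimes u^3+u^3s\otimes u-u^3s\otimes u^3),$$ $$\Delta(v)=\tfrac14v(1+r+s+rs)\otimes v+\tfrac14v(1-\zeta^2r-s+\zeta^2rs)\otimes uv+\tfrac14v(1-r+s-rs)\otimes u^2v+\tfrac14v(1+\zeta^2r-s-\zeta^2rs)\otimes u^3v.$$ The primed generators are the generators $u_{-\zeta},v_{-\zeta},r_{-\zeta},s_{-\zeta}$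 of $B_{-\zeta}$. *)

(* Defs.v *)
From HB Require Import structures.
From mathcomp Require Import all_boot all_order all_algebra boolp.

Set Implicit Arguments.
Unset Strict Implicit.
Unset Printing Implicit Defensive.

Import GRing.Theory.

Local Open Scope ring_scope.
Local Open Scope quotient_scope.

(** Tensors are finite formal sums of pairs (u, v), two formal sums being
    identified when every bilinear map takes the same value on them.  The
    universal property is [tlift], [tliftE] and [tlift_unique]. *)

Section Tensor.
Variables (K : comNzRingType) (U V : lmodType K).

Definition formal_eval (W : lmodType K) (b : {bilinear U -> V -> W})
  (x : seq (U * V)) : W := \sum_(p <- x) b p.1 p.2.

Definition tensor_rel (x y : seq (U * V)) : bool :=
  `[< forall (W : lmodType K) (b : {bilinear U -> V -> W}),
        formal_eval b x = formal_eval b y >].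

Fact tensor_rel_refl : reflexive tensor_rel.
Proof. by move=> x; apply/asboolP. Qed.

Fact tensor_rel_sym : symmetric tensor_rel.
Proof. by move=> x y; apply/asboolP/asboolP => h W b; rewrite h. Qed.

Fact tensor_rel_trans : transitive tensor_rel.
Proof.
by move=> y x z /asboolP h1 /asboolP h2; apply/asboolP => W b; rewrite h1.
Qed.

Canonical tensor_equiv :=
  EquivRel tensor_rel tensor_rel_refl tensor_rel_sym tensor_rel_trans.

Definition tensor : Type := {eq_quot tensor_equiv}.

HB.instance Definition _ := Choice.on tensor.
HB.instance Definition _ := EqQuotient.on tensor.

Definition tensor_eval (W : lmodType K) (b : {bilinear U -> V -> W})
  (t : tensor) : W := formal_eval b (repr t).

Lemma tensor_eval_pi (W : lmodType K) (b : {bilinear U -> V -> W}) x :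
  tensor_eval b (\pi_tensor x) = formal_eval b x.
Proof.
have /eqmodP/asboolP : repr (\pi_tensor x) = x %[mod tensor] by rewrite reprK.
exact.
Qed.

Lemma tensor_eval_inj (s t : tensor) :
  (forall (W : lmodType K) (b : {bilinear U -> V -> W}),
     tensor_eval b s = tensor_eval b t) -> s = t.
Proof.
move=> h; rewrite -[s]reprK -[t]reprK; apply/eqmodP/asboolP => W b.
exact: h.
Qed.

Definition tensor_zero : tensor := \pi_tensor [::].
Definition tensor_add (s t : tensor) : tensor := \pi_tensor (repr s ++ repr t).
Definition tensor_scale (a : K) (t : tensor) : tensor :=
  \pi_tensor [seq (a *: p.1, p.2) | p <- repr t].
Definition tensor_opp : tensor -> tensor := tensor_scale (-1).

Lemma tensor_eval0 (W : lmodType K) (b : {bilinear U -> V -> W}) :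
  tensor_eval b tensor_zero = 0.
Proof. by rewrite tensor_eval_pi /formal_eval big_nil. Qed.

Lemma tensor_evalD (W : lmodType K) (b : {bilinear U -> V -> W}) s t :
  tensor_eval b (tensor_add s t) = tensor_eval b s + tensor_eval b t.
Proof. by rewrite tensor_eval_pi /formal_eval big_cat. Qed.

Lemma tensor_evalZ (W : lmodType K) (b : {bilinear U -> V -> W}) a t :
  tensor_eval b (tensor_scale a t) = a *: tensor_eval b t.
Proof.
rewrite tensor_eval_pi /tensor_eval /formal_eval big_map scaler_sumr.
by apply: eq_bigr => p _; rewrite linearZl_LR.
Qed.

Definition tensor_evalE := (tensor_evalZ, tensor_evalD, tensor_eval0).

Fact tensor_addA : associative tensor_add.
Proof.
by move=> s t w; apply: tensor_eval_inj => W b; rewrite !tensor_evalE addrA.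
Qed.

Fact tensor_addC : commutative tensor_add.
Proof.
by move=> s t; apply: tensor_eval_inj => W b; rewrite !tensor_evalE addrC.
Qed.

Fact tensor_add0 : left_id tensor_zero tensor_add.
Proof.
by move=> s; apply: tensor_eval_inj => W b; rewrite !tensor_evalE add0r.
Qed.

Fact tensor_addN : left_inverse tensor_zero tensor_opp tensor_add.
Proof.
by move=> s; apply: tensor_eval_inj => W b; rewrite !tensor_evalE scaleN1r addNr.
Qed.

HB.instance Definition _ := GRing.isZmodule.Build tensor
  tensor_addA tensor_addC tensor_add0 tensor_addN.

Fact tensor_scaleA a b t :
  tensor_scale a (tensor_scale b t) = tensor_scale (a * b) t.
Proof. by apply: tensor_eval_inj => W c; rewrite !tensor_evalE scalerA. Qed.

Fact tensor_scale1 : left_id 1 tensor_scale.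
Proof.
by move=> t; apply: tensor_eval_inj => W b; rewrite !tensor_evalE scale1r.
Qed.

Fact tensor_scaleDr : right_distributive tensor_scale +%R.
Proof.
by move=> a s t; apply: tensor_eval_inj => W b; rewrite !tensor_evalE scalerDr.
Qed.

Fact tensor_scaleDl t : {morph tensor_scale^~ t : a b / a + b}.
Proof.
by move=> a b; apply: tensor_eval_inj => W c; rewrite !tensor_evalE scalerDl.
Qed.

HB.instance Definition _ := GRing.Zmodule_isLmodule.Build K tensor
  tensor_scaleA tensor_scale1 tensor_scaleDr tensor_scaleDl.

Definition tpure (u : U) (v : V) : tensor := \pi_tensor [:: (u, v)].

Lemma tensor_eval_tpure (W : lmodType K) (b : {bilinear U -> V -> W}) u v :
  tensor_eval b (tpure u v) = b u v.
Proof. by rewrite tensor_eval_pi /formal_eval big_seq1. Qed.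

Fact tpure_is_bilinear : bilinear_for *:%R *:%R tpure.
Proof.
split=> [v a u1 u2|u a v1 v2] /=; apply: tensor_eval_inj => W b;
  rewrite tensor_evalD tensor_evalZ !tensor_eval_tpure.
- by rewrite linearPl.
- by rewrite linearPr.
Qed.

HB.instance Definition _ :=
  bilinear_isBilinear.Build K U V tensor *:%R *:%R tpure tpure_is_bilinear.

Section Lift.
Variables (W : lmodType K) (b : {bilinear U -> V -> W}).

Definition tlift : tensor -> W := tensor_eval b.

Fact tlift_is_linear : linear tlift.
Proof. by move=> a s t; rewrite /tlift tensor_evalD tensor_evalZ. Qed.

HB.instance Definition _ :=
  GRing.isLinear.Build K tensor W *:%R tlift tlift_is_linear.

Lemma tliftE u v : tlift (tpure u v) = b u v.
Proof. exact: tensor_eval_tpure. Qed.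

End Lift.

Lemma tensor_sumE (t : tensor) : exists x : seq (U * V),
  t = \sum_(p <- x) tpure p.1 p.2.
Proof.
exists (repr t); apply: tensor_eval_inj => W b.
transitivity (tlift b (\sum_(p <- repr t) tpure p.1 p.2)); last by [].
by rewrite linear_sum; apply: eq_bigr => p _; rewrite /= tliftE.
Qed.

Lemma tlift_unique (W : lmodType K) (f g : {linear tensor -> W}) :
  (forall u v, f (tpure u v) = g (tpure u v)) -> f =1 g.
Proof.
move=> h t; have [x ->] := tensor_sumE t; rewrite !linear_sum.
by apply: eq_bigr => p _; apply: h.
Qed.

End Tensor.

Notation "u ⊗ v" := (tpure u v) (at level 40, left associativity) : ring_scope.

Lemma tensor_ext (K : comNzRingType) (U V W : lmodType K)
  (f g : tensor U V -> W) : linear f -> linear g ->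
  (forall u v, f (u ⊗ v) = g (u ⊗ v)) -> f =1 g.
Proof.
move=> fl gl.
pose f' : {linear _ -> _} := HB.pack f (GRing.isLinear.Build K _ _ _ f fl).
pose g' : {linear _ -> _} := HB.pack g (GRing.isLinear.Build K _ _ _ g gl).
exact: (@tlift_unique K U V W f' g').
Qed.

Lemma linear_comb (K : comNzRingType) (U V : lmodType K) (k : K)
  (f g : U -> V) : linear f -> linear g -> linear (fun x => k *: f x + g x).
Proof.
move=> fl gl a x y; rewrite fl gl !scalerDr !scalerA (mulrC k a) -!addrA.
by congr (_ + _); rewrite addrCA.
Qed.

Section TensorMap.
Variables (K : comNzRingType) (U V U' V' : lmodType K).
Variables (f : {linear U -> U'}) (g : {linear V -> V'}).

Definition tmap_pure (u : U) (v : V) : tensor U' V' := f u ⊗ g v.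

Fact tmap_pure_is_bilinear : bilinear_for *:%R *:%R tmap_pure.
Proof.
split=> [v a u1 u2|u a v1 v2]; rewrite /tmap_pure /= linearP.
- by rewrite linearPl.
- by rewrite linearPr.
Qed.

HB.instance Definition _ := bilinear_isBilinear.Build K U V (tensor U' V')
  *:%R *:%R tmap_pure tmap_pure_is_bilinear.

Definition tmap : {linear tensor U V -> tensor U' V'} := tlift tmap_pure.

Lemma tmapE u v : tmap (u ⊗ v) = f u ⊗ g v.
Proof. exact: tliftE. Qed.

End TensorMap.

Section TensorAssoc.
Variables (K : comNzRingType) (U V W : lmodType K).

Section Inner.
Variable w : W.

Definition tassoc_pure (u : U) (v : V) : tensor U (tensor V W) := u ⊗ (v ⊗ w).

Fact tassoc_pure_is_bilinear : bilinear_for *:%R *:%R tassoc_pure.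
Proof.
split=> [v a u1 u2|u a v1 v2]; rewrite /tassoc_pure /=.
- by rewrite linearPl.
- by rewrite linearPl linearPr.
Qed.

HB.instance Definition _ := bilinear_isBilinear.Build K U V
  (tensor U (tensor V W)) *:%R *:%R tassoc_pure tassoc_pure_is_bilinear.

End Inner.

Definition tassoc_outer (t : tensor U V) (w : W) : tensor U (tensor V W) :=
  tlift (tassoc_pure w) t.

Fact tassoc_outer_is_bilinear : bilinear_for *:%R *:%R tassoc_outer.
Proof.
split=> [w a s t|t a w1 w2]; rewrite /tassoc_outer /=.
- by rewrite linearP.
- apply: (@tensor_ext K U V _ (tlift (tassoc_pure (a *: w1 + w2)))
    (fun t => a *: tlift (tassoc_pure w1) t + tlift (tassoc_pure w2) t)).
  + exact: linearP.
  + exact: linear_comb (linearP _) (linearP _).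
  + by move=> u v; rewrite /= !tliftE /= /tassoc_pure !linearPr.
Qed.

HB.instance Definition _ := bilinear_isBilinear.Build K (tensor U V) W
  (tensor U (tensor V W)) *:%R *:%R tassoc_outer tassoc_outer_is_bilinear.

Definition tassoc : {linear tensor (tensor U V) W -> tensor U (tensor V W)} :=
  tlift tassoc_outer.

Lemma tassocE u v w : tassoc ((u ⊗ v) ⊗ w) = u ⊗ (v ⊗ w).
Proof. by rewrite /tassoc /= tliftE /= /tassoc_outer tliftE. Qed.

End TensorAssoc.

Section TensorAlgebra.
Variables (K : comNzRingType) (A B : algType K).

Section Inner.
Variables (a : A) (b : B).

Definition tmul_pure (c : A) (d : B) : tensor A B := (a * c) ⊗ (b * d).

Fact tmul_pure_is_bilinear : bilinear_for *:%R *:%R tmul_pure.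
Proof.
split=> [d k c1 c2|c k d1 d2]; rewrite /tmul_pure /= mulrDr -scalerAr.
- by rewrite linearPl.
- by rewrite linearPr.
Qed.

HB.instance Definition _ := bilinear_isBilinear.Build K A B
  (tensor A B) *:%R *:%R tmul_pure tmul_pure_is_bilinear.

End Inner.

Section Outer.
Variable t : tensor A B.

Definition tmul_outer (a : A) (b : B) : tensor A B := tlift (tmul_pure a b) t.

Fact tmul_outer_is_bilinear : bilinear_for *:%R *:%R tmul_outer.
Proof.
have comb (x y : A * B) k : linear (fun t =>
    k *: tlift (tmul_pure x.1 x.2) t + tlift (tmul_pure y.1 y.2) t).
  exact: linear_comb (linearP _) (linearP _).
split=> [b k a1 a2|a k b1 b2]; rewrite /tmul_outer /=.
- apply: (tensor_ext (linearP (tlift (tmul_pure (k *: a1 + a2) b)))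
    (comb (a1, b) (a2, b) k)) => c d.
  by rewrite /= !tliftE /= /tmul_pure mulrDl -scalerAl linearPl.
- apply: (tensor_ext (linearP (tlift (tmul_pure a (k *: b1 + b2))))
    (comb (a, b1) (a, b2) k)) => c d.
  by rewrite /= !tliftE /= /tmul_pure mulrDl -scalerAl linearPr.
Qed.

HB.instance Definition _ := bilinear_isBilinear.Build K A B
  (tensor A B) *:%R *:%R tmul_outer tmul_outer_is_bilinear.

End Outer.

Definition tmul (s t : tensor A B) : tensor A B := tlift (tmul_outer t) s.
Definition tone : tensor A B := 1 ⊗ 1.

Lemma tmul_pureE a b c d : tmul (a ⊗ b) (c ⊗ d) = (a * c) ⊗ (b * d).
Proof. by rewrite /tmul /= tliftE /= /tmul_outer tliftE. Qed.

Fact tmul_linearl t : linear (tmul^~ t).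
Proof. by move=> k s s'; rewrite /tmul linearP. Qed.

Fact tmul_linearr s : linear (tmul s).
Proof.
move=> k t t'.
apply: (tensor_ext (tmul_linearl (k *: t + t'))
  (g := fun s => k *: tmul s t + tmul s t')) => [|a b].
  exact: linear_comb (tmul_linearl t) (tmul_linearl t').
by rewrite /tmul !tliftE /= /tmul_outer linearP.
Qed.

Fact tmulA : associative tmul.
Proof.
move=> s t w.
apply: (tensor_ext (f := fun s => tmul s (tmul t w))
  (g := fun s => tmul (tmul s t) w)) => [||a b].
- exact: tmul_linearl.
- by move=> k x y; rewrite !tmul_linearl.
apply: (tensor_ext (f := fun t => tmul (a ⊗ b) (tmul t w))
  (g := fun t => tmul (tmul (a ⊗ b) t) w)) => [||c d].
- by move=> k x y; rewrite tmul_linearl tmul_linearr.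
- by move=> k x y; rewrite tmul_linearr tmul_linearl.
apply: (tensor_ext (f := fun w => tmul (a ⊗ b) (tmul (c ⊗ d) w))
  (g := fun w => tmul (tmul (a ⊗ b) (c ⊗ d)) w)) => [||x y].
- by move=> k x y; rewrite !tmul_linearr.
- exact: tmul_linearr.
by rewrite !tmul_pureE !mulrA.
Qed.

Fact tmul1l : left_id tone tmul.
Proof.
apply: (tensor_ext (g := id)) => [||a b]; [exact: tmul_linearr|by []|].
by rewrite tmul_pureE !mul1r.
Qed.

Fact tmul1r : right_id tone tmul.
Proof.
apply: (tensor_ext (f := tmul^~ tone) (g := id)) => [||a b];
  [exact: tmul_linearl|by []|].
by rewrite tmul_pureE !mulr1.
Qed.

Fact tmulDl : left_distributive tmul +%R.
Proof. by move=> s t w; have := tmul_linearl w 1 s t; rewrite !scale1r. Qed.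

Fact tmulDr : right_distributive tmul +%R.
Proof. by move=> s t w; have := tmul_linearr s 1 t w; rewrite !scale1r. Qed.

(* [algType] requires 1 != 0, which can fail in A ⊗ B over a general K; hence
   [pzRingType] and [lmodType], with [tensor_scaleAl] and [tensor_scaleAr]. *)
HB.instance Definition _ := GRing.Zmodule_isPzRing.Build (tensor A B)
  tmulA tmul1l tmul1r tmulDl tmulDr.

Lemma tpureM (a c : A) (b d : B) : (a ⊗ b) * (c ⊗ d) = (a * c) ⊗ (b * d).
Proof. exact: tmul_pureE. Qed.

Lemma tpure11 : (1 : A) ⊗ (1 : B) = 1.
Proof. by []. Qed.

Lemma tensor_scaleAl (k : K) (s t : tensor A B) : k *: (s * t) = (k *: s) * t.
Proof. by have := tmul_linearl t k s 0; rewrite /tmul linear0 !addr0. Qed.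

Lemma tensor_scaleAr (k : K) (s t : tensor A B) : k *: (s * t) = s * (k *: t).
Proof.
have := tmul_linearr s k t 0.
have -> : tmul s 0 = 0 by have := tmulDr s 0 0; rewrite addr0 => /eqP;
  rewrite -subr_eq subrr => /eqP.
by rewrite !addr0.
Qed.

End TensorAlgebra.

Section UnitMaps.
Variables (K : comNzRingType) (V : lmodType K).

Definition tunitl_pure (k : K^o) (v : V) : V := k *: v.
Definition tunitr_pure (v : V) (k : K^o) : V := k *: v.

Fact tunitl_pure_is_bilinear : bilinear_for *:%R *:%R tunitl_pure.
Proof.
split=> [v a k1 k2|k a v1 v2]; rewrite /tunitl_pure /=.
- by rewrite scalerDl scalerA.
- by rewrite scalerDr !scalerA mulrC.
Qed.

Fact tunitr_pure_is_bilinear : bilinear_for *:%R *:%R tunitr_pure.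
Proof. by have [l r] := tunitl_pure_is_bilinear; split. Qed.

HB.instance Definition _ := bilinear_isBilinear.Build K K^o V V
  *:%R *:%R tunitl_pure tunitl_pure_is_bilinear.
HB.instance Definition _ := bilinear_isBilinear.Build K V K^o V
  *:%R *:%R tunitr_pure tunitr_pure_is_bilinear.

Definition tunitl : {linear tensor K^o V -> V} := tlift tunitl_pure.
Definition tunitr : {linear tensor V K^o -> V} := tlift tunitr_pure.

Lemma tunitlE k v : tunitl (k ⊗ v) = (k : K) *: v.
Proof. by rewrite /tunitl /= tliftE. Qed.

Lemma tunitrE k v : tunitr (v ⊗ k) = (k : K) *: v.
Proof. by rewrite /tunitr /= tliftE. Qed.

End UnitMaps.

Section MulMap.
Variables (K : comNzRingType) (A : algType K).

Definition mul_pure (a b : A) : A := a * b.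

Fact mul_pure_is_bilinear : bilinear_for *:%R *:%R mul_pure.
Proof.
split=> [b k a1 a2|a k b1 b2]; rewrite /mul_pure /=.
- by rewrite mulrDl scalerAl.
- by rewrite mulrDr scalerAr.
Qed.

HB.instance Definition _ := bilinear_isBilinear.Build K A A A
  *:%R *:%R mul_pure mul_pure_is_bilinear.

Definition mulmap : {linear tensor A A -> A} := tlift mul_pure.

Lemma mulmapE a b : mulmap (a ⊗ b) = a * b.
Proof. by rewrite /mulmap /= tliftE. Qed.

End MulMap.

HB.mixin Record isHopfAlgebra (K : fieldType) H of GRing.Algebra K H := {
  comul : {linear H -> tensor H H};
  counit : {linear H -> K^o};
  antipode : {linear H -> H};
  comul_monoid_morphism : monoid_morphism comul;
  counit_monoid_morphism : monoid_morphism (counit : H -> K);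
  comulA : forall x : H,
    tassoc H H H (tmap comul idfun (comul x)) = tmap idfun comul (comul x);
  comul_counitl : forall x : H, tunitl H (tmap counit idfun (comul x)) = x;
  comul_counitr : forall x : H, tunitr H (tmap idfun counit (comul x)) = x;
  antipodel : forall x : H,
    mulmap H (tmap antipode idfun (comul x)) = (counit x : K)%:A;
  antipoder : forall x : H,
    mulmap H (tmap idfun antipode (comul x)) = (counit x : K)%:A
}.

#[short(type="hopfAlgType")]
HB.structure Definition HopfAlgebra (K : fieldType) :=
  {H of isHopfAlgebra K H & GRing.Algebra K H}.

Section HopfAlgebraTheory.
Variables (K : fieldType) (H : hopfAlgType K).
Implicit Types x y : H.

Lemma comul1 : comul (1 : H) = 1 ⊗ 1.
Proof. by rewrite (comul_monoid_morphism (s := H)).1. Qed.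

Lemma comulM x y : comul (x * y) = comul x * comul y.
Proof. exact: (comul_monoid_morphism (s := H)).2. Qed.

Lemma counit1 : counit (1 : H) = 1.
Proof. exact: (counit_monoid_morphism (s := H)).1. Qed.

Lemma counitM x y : counit (x * y) = (counit x : K) * counit y.
Proof. exact: (counit_monoid_morphism (s := H)).2. Qed.

End HopfAlgebraTheory.

Record is_hopf_isomorphism (K : fieldType) (H H' : hopfAlgType K)
    (f : {lrmorphism H -> H'}) : Prop := IsHopfIsomorphism {
  hopf_iso_comul : forall x, comul (f x) = tmap f f (comul x);
  hopf_iso_counit : forall x, counit (f x) = counit x;
  hopf_iso_antipode : forall x, antipode (f x) = f (antipode x);
  hopf_iso_bij : bijective f
}.

Section BZeta.
Variables (K : fieldType) (zeta : K).

Record B_relations (A : algType K) (u v r s : A) : Prop := BRelations {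
  B_u4 : u ^+ 4 = 1;
  B_uv : u * v = v * u;
  B_v2 : v ^+ 2 = 2%:R^-1 *: (1 + zeta *: u + u ^+ 2 - zeta *: u ^+ 3);
  B_r2 : r ^+ 2 = 1;
  B_rs : r * s = s * r;
  B_s2 : s ^+ 2 = 1;
  B_ru : r * u = u ^+ 3 * r;
  B_rv : r * v = u ^+ 3 * v * r;
  B_su : s * u = u * s;
  B_sv : s * v = u ^+ 2 * v * s
}.

(* The universal property of the quotient of the free algebra on u, v, r, s by
   the ideal of relations. *)
Definition B_presented (B : algType K) (u v r s : B) : Prop :=
  B_relations u v r s /\
  forall (A : algType K) (a b c d : A), B_relations a b c d ->
    exists f : {lrmorphism B -> A},
      [/\ f u = a, f v = b, f r = c & f s = d] /\
      forall g : {lrmorphism B -> A},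
        [/\ g u = a, g v = b, g r = c & g s = d] -> g =1 f.

Definition B_basis (B : algType K) (u v r s : B) : Prop :=
  forall x : B, exists! c : {ffun 'I_4 * 'I_2 * 'I_2 * 'I_2 -> K},
    x = \sum_(i < 4) \sum_(j < 2) \sum_(k < 2) \sum_(l < 2)
          c (i, j, k, l) *: (u ^+ i * v ^+ j * r ^+ k * s ^+ l).

Definition grouplike (H : hopfAlgType K) (g : H) : Prop :=
  comul g = g ⊗ g /\ counit g = 1.

Definition B_comul_u (H : hopfAlgType K) (u s : H) : tensor H H :=
  2%:R^-1 *: (u ⊗ u + u ⊗ u ^+ 3 + (u ^+ 3 * s) ⊗ u - (u ^+ 3 * s) ⊗ u ^+ 3).

(* [*:] and [⊗] have the same level and associate to the left. *)
Definition B_comul_v (H : hopfAlgType K) (u v r s : H) : tensor H H :=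
  4%:R^-1 *: (v * (1 + r + s + r * s)) ⊗ v
  + 4%:R^-1 *: (v * (1 - zeta ^+ 2 *: r - s + zeta ^+ 2 *: (r * s)))
      ⊗ (u * v)
  + 4%:R^-1 *: (v * (1 - r + s - r * s)) ⊗ (u ^+ 2 * v)
  + 4%:R^-1 *: (v * (1 + zeta ^+ 2 *: r - s - zeta ^+ 2 *: (r * s)))
      ⊗ (u ^+ 3 * v).

Record is_B (H : hopfAlgType K) (u v r s : H) : Prop := IsB {
  B_is_presented : B_presented u v r s;
  B_has_basis : B_basis u v r s;
  B_grouplike_r : grouplike r;
  B_grouplike_s : grouplike s;
  B_counit_u : counit u = 1;
  B_counit_v : counit v = 1;
  B_comul_uE : comul u = B_comul_u u s;
  B_comul_vE : comul v = B_comul_v u v r s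
}.

End BZeta.

(* Main.v *)
(* The elements u'^3, v', r's', s' of B_{-zeta} satisfy the relations of B_zeta,
   which gives an algebra map f; the same substitution with the roles of zeta
   and -zeta exchanged gives g, and gf and fg fix the generators because
   u^9 = u and s^2 = 1.  Compatibility with the counit and the
   comultiplication need only be checked on generators.  For u it is
   a formula for Delta(u')^3, which comes from the fact that u'^2 is
   group-like; for v, f exchanges the second and fourth terms of Delta(v).  A
   bialgebra map between Hopf algebras preserves the antipode. *)
Require Import Defs.
From HB Require Import structures.
From mathcomp Require Import all_boot all_order all_algebra boolp.

Set Implicit Arguments.
Unset Strict Implicit.
Unset Printing Implicit Defensive.

Import GRing.Theory.

Local Open Scope ring_scope.

Lemma addr_swap24 (V : nmodType) (x y z t : V) :
  x + y + z + t = x + t + z + y.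
Proof. by rewrite addrAC (addrAC x) addrAC. Qed.

(** The monomials in the generators span [B], so stability under linear combinations and products
    reduces a property to the generators. *)
Lemma B_ind (K : fieldType) (B : algType K) (u v r s : B) (P : B -> Prop) :
  B_basis u v r s -> P 0 -> P 1 ->
  (forall k x y, P x -> P y -> P (k *: x + y)) ->
  (forall x y, P x -> P y -> P (x * y)) ->
  P u -> P v -> P r -> P s -> forall x, P x.
Proof.
move=> basis P0 P1 Plin PM Pu Pv Pr Ps x; have [c [-> _]] := basis x.
have PD y z : P y -> P z -> P (y + z).
  by move=> Py Pz; rewrite -[y]scale1r; apply: Plin.
have PX y n : P y -> P (y ^+ n).
  by move=> Py; elim: n => [|n IHn]; rewrite ?expr0 ?exprS; auto.
do 4![apply: (big_ind P) => [||? _] //].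
(* Adding 0 gives a single scaled monomial the shape [k *: x + y]. *)
by rewrite -[X in P X]addr0; apply: Plin => //;
  apply: (PM _ _ (PM _ _ (PM _ _ _ _) _) _); apply: PX.
Qed.

Lemma B_lrmorphism_id (K : fieldType) (B : algType K) (u v r s : B)
    (f : {lrmorphism B -> B}) :
  B_basis u v r s -> f u = u -> f v = v -> f r = r -> f s = s -> f =1 id.
Proof.
move=> basis fu fv fr fs; apply: (B_ind basis) => //.
- exact: linear0.
- exact: rmorph1.
- by move=> k x y fx fy; rewrite linearP /= fx fy.
- by move=> x y fx fy; rewrite rmorphM /= fx fy.
Qed.

(** Cubing exchanges [u] and [u ^+ 3], which flips the sign of the odd part of the formula for $v^2$
    and so absorbs the passage from [- z] to [z]. *)
Lemma B_relations_twist (K : fieldType) (z : K) (A : algType K) (u v r s : A) :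
  B_relations (- z) u v r s -> B_relations z (u ^+ 3) v (r * s) s.
Proof.
case=> u4 uv v2 r2 rs s2 ru rv su sv.
have uX n : u ^+ (n + 4) = u ^+ n by rewrite exprD u4 mulr1.
have u9 : (u ^+ 3) ^+ 3 = u by rewrite -exprM (uX 5) (uX 1).
have u6 : (u ^+ 3) ^+ 2 = u ^+ 2 by rewrite -exprM (uX 2).
have suX n : s * u ^+ n = u ^+ n * s.
  by apply: (@commrX _ s u n); rewrite /GRing.comm.
have ruX n : r * u ^+ n = u ^+ (3 * n) * r.
  elim: n => [|n IHn]; first by rewrite mulr1 mul1r.
  by rewrite exprS mulrA ru -mulrA IHn mulrA -exprD mulnS.
split=> //.
- by rewrite -exprM mulnC exprM u4 expr1n.
- by apply/esym; apply: (@commrX _ v u 3); rewrite /GRing.comm uv.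
- rewrite v2 u9 u6 !scaleNr opprK; congr (_ *: _).
  by rewrite addrAC [RHS]addrAC [in RHS](addrAC 1).
- by rewrite exprMn_comm // r2 s2 mulr1.
- by rewrite mulrA -rs.
- by rewrite -mulrA suX mulrA ruX -mulrA -exprM.
(* $rsv = ru^2vs = u^6rvs = u^9vrs = uvrs$. *)
- rewrite u9 -mulrA sv (mulrA r) (mulrA r) ruX -(mulrA _ r v) rv.
  rewrite -(mulrA (u ^+ 3)) (mulrA _ (u ^+ 3)) -exprD (uX 5) (uX 1) expr1.
  by rewrite !mulrA.
- by rewrite u6 sv.
Qed.

Lemma tmap_sum (K : comNzRingType) (U V U' V' : lmodType K)
    (f : {linear U -> U'}) (g : {linear V -> V'}) I (p : seq I) F G :
  tmap f g (\sum_(i <- p) F i ⊗ G i) = \sum_(i <- p) f (F i) ⊗ g (G i).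
Proof. by rewrite linear_sum; apply: eq_bigr => i _; rewrite tmapE. Qed.

Lemma mulmap_sum (K : comNzRingType) (A : algType K) I (p : seq I)
    (F G : I -> A) :
  mulmap A (\sum_(i <- p) F i ⊗ G i) = \sum_(i <- p) F i * G i.
Proof. by rewrite linear_sum; apply: eq_bigr => i _; rewrite mulmapE. Qed.

Lemma tmapM (K : comNzRingType) (A B A' B' : algType K)
    (f : {lrmorphism A -> A'}) (g : {lrmorphism B -> B'}) (t t' : tensor A B) :
  tmap f g (t * t') = tmap f g t * tmap f g t'.
Proof.
move: t; apply: tensor_ext => [k x y|k x y|a b];
  rewrite ?linearP ?mulrDl -?tensor_scaleAl ?linearP //.
move: t'; apply: tensor_ext => [k x y|k x y|c d];
  rewrite ?linearP ?mulrDr -?tensor_scaleAr ?linearP //.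
by rewrite tpureM !tmapE !rmorphM tpureM.
Qed.

Lemma comulX (K : fieldType) (H : hopfAlgType K) (x : H) n :
  comul (x ^+ n) = comul x ^+ n.
Proof.
by elim: n => [|n IHn]; rewrite ?comul1 // !exprS comulM IHn.
Qed.

Section Convolution.
Variables (K : fieldType) (H : hopfAlgType K) (A : algType K).
Implicit Types f g h : {linear H -> A}.

Definition convolution f g : {linear H -> A} :=
  mulmap A \o (tmap f g \o comul).

Lemma convolutionE f g x :
  convolution f g x = mulmap A (tmap f g (comul x)).
Proof. by []. Qed.

(** The half of the associativity of convolution that comes from associativity in [A];
    coassociativity of [H] gives the other half. *)
Lemma mulmap_assoc f g h (t : tensor (tensor H H) H) :
  mulmap A (tmap (mulmap A \o tmap f g) h t) =
  mulmap A (tmap f (mulmap A \o tmap g h) (tassoc H H H t)).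
Proof.
move: t; apply: tensor_ext => [k x y|k x y|t c]; rewrite ?linearP //.
move: t; apply: tensor_ext => [k x y|k x y|a b]; rewrite ?linearPl ?linearP //.
rewrite tassocE !tmapE !mulmapE.
change (mulmap A (tmap f g (a ⊗ b)) * h c =
        f a * mulmap A (tmap g h (b ⊗ c))).
by rewrite !tmapE !mulmapE mulrA.
Qed.

Lemma convolutionA f g h :
  convolution (convolution f g) h =1 convolution f (convolution g h).
Proof.
move=> x; rewrite !convolutionE.
transitivity (mulmap A (tmap (mulmap A \o tmap f g) h
    (tmap comul idfun (comul x)))).
  have [p ->] := tensor_sumE (comul x).
  by rewrite [tmap comul _ _]tmap_sum !tmap_sum.
rewrite mulmap_assoc comulA.
have [p ->] := tensor_sumE (comul x).
by rewrite [tmap _ comul _]tmap_sum !tmap_sum.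
Qed.

(** The map $x \mapsto \varepsilon(x)1$ is the unit of convolution: apply [g] to $x = (\varepsilon
    \otimes \mathrm{id})\Delta(x)$. The hypothesis concerns only the values of [f], so that [f] may
    itself be a convolution. *)
Lemma convolution_counitl f g :
  (forall x, f x = (counit x : K)%:A) -> convolution f g =1 g.
Proof.
move=> fE x; rewrite -[in RHS](comul_counitl x) convolutionE.
have [p ->] := tensor_sumE (comul x).
rewrite !tmap_sum mulmap_sum [tunitl _ _]linear_sum linear_sum.
apply: eq_bigr => q _.
by rewrite tunitlE fE -scalerAl mul1r linearZ.
Qed.

Lemma convolution_counitr f g :
  (forall x, g x = (counit x : K)%:A) -> convolution f g =1 f.
Proof.
move=> gE x; rewrite -[in RHS](comul_counitr x) convolutionE.
have [p ->] := tensor_sumE (comul x).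
rewrite !tmap_sum mulmap_sum [tunitr _ _]linear_sum linear_sum.
apply: eq_bigr => q _.
by rewrite tunitrE gE -scalerAr mulr1 linearZ.
Qed.

End Convolution.

(* Both sides are convolution inverses of [f]. *)
Lemma bialgebra_morphism_antipode (K : fieldType) (H H' : hopfAlgType K)
    (f : {lrmorphism H -> H'}) :
  (forall x, comul (f x) = tmap f f (comul x)) ->
  (forall x, counit (f x) = counit x) ->
  forall x, antipode (f x) = f (antipode x).
Proof.
move=> f_comul f_counit x.
(* This is the antipode axiom of [H'] at [f y], pulled back through the coalgebra map [f]. *)
have inv_l y : convolution (antipode \o f) f y = (counit y : K)%:A.
  rewrite -f_counit -antipodel f_comul convolutionE.
  have [p ->] := tensor_sumE (comul y).
  by rewrite [tmap f f _]tmap_sum !tmap_sum.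
(* This is the antipode axiom of [H] at [y], pushed forward by the algebra map [f]. *)
have inv_r y : convolution f (f \o antipode) y = (counit y : K)%:A.
  rewrite -[RHS](rmorph_alg f) -antipoder convolutionE.
  have [p ->] := tensor_sumE (comul y).
  rewrite !tmap_sum !mulmap_sum [RHS]linear_sum.
  by apply: eq_bigr => q _; rewrite rmorphM.
transitivity (convolution (antipode \o f) (convolution f (f \o antipode)) x).
  by rewrite convolution_counitr.
by rewrite -convolutionA convolution_counitl.
Qed.

(** Group the terms as $\frac12(u\otimes p + u^3s\otimes m)$ with $p = u+u^3$ and $m = u-u^3$. The
    cross terms vanish because $pm = mp = 0$; both left factors square to $u^2$, and $p^2+m^2 =
    4u^2$. *)
Lemma B_comul_u_sqr (K : fieldType) (H : hopfAlgType K) (u s : H) :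
  2%:R != 0 :> K -> u ^+ 4 = 1 -> s ^+ 2 = 1 -> s * u = u * s ->
  B_comul_u u s ^+ 2 = u ^+ 2 ⊗ u ^+ 2.
Proof.
move=> two u4 s2 su.
have uX n : u ^+ (n + 4) = u ^+ n by rewrite exprD u4 mulr1.
have suX n : s * u ^+ n = u ^+ n * s.
  by apply: (@commrX _ s u n); rewrite /GRing.comm.
have -> : B_comul_u u s =
    2%:R^-1 *: (u ⊗ (u + u ^+ 3) + (u ^+ 3 * s) ⊗ (u - u ^+ 3)).
  by rewrite /B_comul_u linearDr linearBr /= addrA.
have u13 : u * u ^+ 3 = 1 by rewrite -exprS.
have u31 : u ^+ 3 * u = 1 by rewrite -exprSr.
have u33 : u ^+ 3 * u ^+ 3 = u ^+ 2 by rewrite -exprD (uX 2).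
have pm : (u + u ^+ 3) * (u - u ^+ 3) = 0.
  by rewrite mulrDl !mulrBr u13 u31 u33 addrA subrK subrr.
have mp : (u - u ^+ 3) * (u + u ^+ 3) = 0.
  by rewrite mulrBl !mulrDr u13 u31 u33 (addrC 1) subrr.
have sq : (u + u ^+ 3) * (u + u ^+ 3) + (u - u ^+ 3) * (u - u ^+ 3)
    = 4%:R *: u ^+ 2.
  rewrite mulrDl mulrBl !mulrBr !mulrDr u13 u31 u33 -expr2.
  rewrite opprB (addrC 1) -!mulr2n.
  by rewrite -mulrnDl addrACA subrr addr0 -mulr2n -mulrnA scaler_nat.
rewrite expr2 -tensor_scaleAl -tensor_scaleAr scalerA.
rewrite mulrDl !mulrDr !tpureM pm mp !linear0r addr0 add0r.
have -> : u ^+ 3 * s * (u ^+ 3 * s) = u ^+ 2.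
  by rewrite mulrA -(mulrA _ s) suX mulrA u33 -mulrA -expr2 s2 mulr1.
rewrite -linearDr sq linearZr_LR scalerA (natrM _ 2 2) mulrA mulfVK //.
by rewrite mulVf // scale1r.
Qed.

(** By the square formula the cube is $u^2\otimes u^2$ times the original, and multiplication by
    $u^2$ exchanges $u$ and $u^3$ in both tensor factors. *)
Lemma B_comul_u_cube (K : fieldType) (H : hopfAlgType K) (u s : H) :
  2%:R != 0 :> K -> u ^+ 4 = 1 -> s ^+ 2 = 1 -> s * u = u * s ->
  B_comul_u u s ^+ 3 = B_comul_u (u ^+ 3) s.
Proof.
move=> two u4 s2 su.
have uX n : u ^+ (n + 4) = u ^+ n by rewrite exprD u4 mulr1.
have u9 : (u ^+ 3) ^+ 3 = u by rewrite -exprM (uX 5) (uX 1).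
have u23 : u ^+ 2 * u ^+ 3 = u by rewrite -exprD (uX 1).
rewrite exprSr B_comul_u_sqr // /B_comul_u u9.
rewrite -tensor_scaleAr mulrBr !mulrDr !tpureM.
by rewrite (mulrA _ (u ^+ 3)) u23 -exprSr.
Qed.

Theorem proposition2p5 (K : closedFieldType) (charK0 : [pchar K] =i pred0)
    (zeta : K) (zeta4 : zeta ^+ 4 = 1)
    (B : hopfAlgType K) (u v r s : B) (hB : is_B zeta u v r s)
    (B' : hopfAlgType K) (u' v' r' s' : B') (hB' : is_B (- zeta) u' v' r' s') :
  exists f : {lrmorphism B -> B'},
    is_hopf_isomorphism f /\
    [/\ f u = u' ^+ 3, f v = v', f r = r' * s' & f s = s'].
Proof.
have two : 2%:R != 0 :> K by rewrite ((pcharf0P K).1 charK0).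
case: hB => -[relB univB] basisB [r_comul r_counit] [s_comul s_counit].
case: hB' => -[relB' univB'] basisB' [r'_comul r'_counit] [s'_comul s'_counit].
move=> u'_counit v'_counit u'_comul v'_comul.
move=> u_counit v_counit u_comul v_comul.
have [f [[fu fv fr fs] _]] := univB _ _ _ _ _ (B_relations_twist relB').
(* Writing $\zeta$ as $-(-\zeta)$ lets the same substitution lemma produce the map back. *)
have relB_opp : B_relations (- - zeta) u v r s by rewrite opprK.
have [g [[gu gv gr gs] _]] := univB' _ _ _ _ _ (B_relations_twist relB_opp).
have [u'4 _ _ _ _ s'2 _ _ s'u' _] := relB'.
have [u4 _ _ _ _ s2 _ _ _ _] := relB.
have u'X n : u' ^+ (n + 4) = u' ^+ n by rewrite exprD u'4 mulr1.
have u'9 : (u' ^+ 3) ^+ 3 = u' by rewrite -exprM (u'X 5) (u'X 1).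
have u'6 : (u' ^+ 3) ^+ 2 = u' ^+ 2 by rewrite -exprM (u'X 2).
have u9 : (u ^+ 3) ^+ 3 = u.
  by rewrite -exprM (exprD u 5 4) u4 mulr1 (exprD u 1 4) u4 mulr1.
have rss : r * s * s = r by rewrite -mulrA -expr2 s2 mulr1.
have rss' : r' * s' * s' = r' by rewrite -mulrA -expr2 s'2 mulr1.
exists f; split; last by [].
have fZ k x : f (k *: x) = k *: f x by exact: linearZ.
have f_comul x : comul (f x) = tmap f f (comul x).
  move: x; apply: (B_ind basisB).
  - by rewrite !linear0.
  - by rewrite rmorph1 !comul1 tmapE rmorph1.
  - by move=> k x y IHx IHy; rewrite !linearP IHx IHy.
  - by move=> x y IHx IHy; rewrite rmorphM !comulM IHx IHy tmapM.
  - rewrite fu comulX u'_comul B_comul_u_cube // u_comul /B_comul_u.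
    rewrite [RHS]linearZ [tmap f f (_ - _)]linearB ![tmap f f (_ + _)]linearD.
    by rewrite !tmapE !(rmorphXn, rmorphM) /= fu fs.
  (* The sign of $\zeta$ disappears since only $\zeta^2$ occurs; $u\mapsto u'^3$ and $u^3\mapsto u'$
     account for the exchange of the outer terms. *)
  - rewrite fv v'_comul v_comul /B_comul_v ![tmap f f (_ + _)]linearD !tmapE.
    rewrite /= !fZ !(rmorphXn, rmorphM) !(rmorphB, rmorphD) !rmorph1 /= !fZ.
    rewrite !rmorphM /= fu fv fr fs u'9 u'6 rss' sqrrN [RHS]addr_swap24.
    (* Inside each coefficient, $r\mapsto r's'$ and $rs\mapsto r'$ exchange the second and fourth
       summands. *)
    by congr (_ *: (_ * _) ⊗ _ + _ *: (_ * _) ⊗ _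
      + _ *: (_ * _) ⊗ _ + _ *: (_ * _) ⊗ _); rewrite addr_swap24.
  - by rewrite fr r_comul tmapE /= fr comulM r'_comul s'_comul tpureM.
  - by rewrite fs s_comul tmapE /= fs s'_comul.
have f_counit x : counit (f x) = counit x.
  move: x; apply: (B_ind basisB).
  - by rewrite !linear0.
  - by rewrite rmorph1 !counit1.
  - by move=> k x y IHx IHy; rewrite !linearP IHx IHy.
  - by move=> x y IHx IHy; rewrite rmorphM !counitM IHx IHy.
  - by rewrite fu !exprS !counitM u'_counit u_counit counit1 !mulr1.
  - by rewrite fv v'_counit.
  - by rewrite fr counitM r'_counit s'_counit r_counit mulr1.
  - by rewrite fs s'_counit.
split=> //; first exact: bialgebra_morphism_antipode.
exists g.
- apply: (B_lrmorphism_id (f := g \o f) basisB) => //=.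
  + by rewrite fu rmorphXn /= gu u9.
  + by rewrite fv gv.
  + by rewrite fr rmorphM /= gr gs rss.
  + by rewrite fs gs.
- apply: (B_lrmorphism_id (f := f \o g) basisB') => //=.
  + by rewrite gu rmorphXn /= fu u'9.
  + by rewrite gv fv.
  + by rewrite gr rmorphM /= fr fs rss'.
  + by rewrite gs fs.
Qed.
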